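(* For all $c\in\mathbb{N}^+$, as $n\to\infty$, $$\sup\left\{\frac{|f|_{\mathcal{C}}}{|f|_{\mathcal{U}^c}}: f\in H^n,\ |f|_{\mathcal{U}^c}<+\infty\right\}\in O(n^c\log^2 n).$$
   Context: Let $\mathcal{B}=\{0,1\}$, let $\mathcal{B}^*$ be the set of finite binary strings and $|h|$ the length of $h\in\mathcal{B}^*$. For $n\in\mathbb{N}^+$, $H^n$ is the set of all functions $\mathcal{B}^n\to\mathcal{B}$. An interpreter is a Turing machine computing a partial function $\varphi:\mathcal{B}^*\times\mathcal{B}^*\to\mathcal{B}\cup\{\bot\}$, where $\bot$ denotes non-halting (or invalid) output. For $f\in H^n$, $|f|_\varphi=\min\{|h|:\varphi(h,x)=f(x)\ \forall x\in\mathcal{B}^n\}$ ($+\infty$ if no such $h$). Turing machines have alphabet $\{0,1,b\}$ ($b$ blank), a finite state set containing an initial state and two final states accept/reject; the output is $1$ if halting in accept, $0$ if halting in reject, $\bot$ otherwise; multi-tape machines have read-only input tapes and read/write work tapes, and the transition function is a finite list of rules. $E(T)$ is a fixed prefix-free binary encoding of a machine $T$ listing its rules (of length at least 2 for every machine). For $c\in\mathbb{N}^+$, $\mathcal{U}^c$ is a time-bounded universal interpreter (a 2-input-tape, 3-work-tape machine): on $(p,x)$ with $n=|x|$, it checks within $n^c$ steps whether $p=E(T)u$ for a two-input-tape machine $T$ and $u\in\mathcal{B}^*$ (outputting $\bot$ if not, or if the check does not finish), then simulates $T$ on $(u,x)$ with an efficient universal simulation (Hennie–Stearns, overhead $O(t\log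 t)$ for $t$ simulated steps), devoting at most $n^c$ of its own steps to the simulation; it outputs $T$'s output if $T$ halts within this budget and $0$ otherwise. For fixed $p$ it runs in at most $\beta n^c$ steps for a constant $\beta$. A Boolean circuit on $n$ inputs is a DAG with a unique sink (output) whose sources are labelled by input indices in $\{1,\dots,n\}$ and whose other vertices (gates) are labelled AND, OR (two incoming edges) or NOT (one incoming edge); its size $|C|$ is its number of vertices. The circuit interpreter $\mathcal{C}$ reads a program $h=0^{\lceil\log_2 n\rceil}1\,[\text{binary expansion of } n]\,0^{|C|}1\,[\text{description of vertex } i]_{i=1}^{|C|}$, each vertex being described by its label and its parents/input index using $\max\{2\lceil\log_2|C|\rceil,\lceil\log_2 n\rceil\}$ bits beyond the label bits, so a circuit $C$ on $n$ inputs has encoding length $L(|C|,n)=2\lceil\log_2 n\rceil+2+|C|(3+\max\{2\lceil\log_2|C|\rceil,\lceil\log_2 n\rceil\})$; $\mathcal{C}(h,x)$ is the circuit's output on $x\in\mathcal{B}^n$, and $\bot$ if $h$ is malformed. Hence $|f|_{\mathcal{C}}=\min\{L(|C|,n): C \text{ computes } f\}$. *)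

(* Defs.v *)
From Stdlib Require Import Bool List ZArith Arith Reals.
Import ListNotations.

Inductive sym := S0 | S1 | SB.
Inductive mv := ML | MR | MS.

Definition sym_eqb (a b : sym) : bool :=
  match a, b with
  | S0, S0 | S1, S1 | SB, SB => true
  | _, _ => false
  end.

Fixpoint syms_eqb (l1 l2 : list sym) : bool :=
  match l1, l2 with
  | [], [] => true
  | a :: l1', b :: l2' => sym_eqb a b && syms_eqb l1' l2'
  | _, _ => false
  end.

(* A rule: in state [r_state] reading [r_read] (one symbol per input tape,
   then one per work tape), go to [r_next], write [r_write] on the work
   tapes, and move every head according to [r_move]. *)
Record rule := mkRule {
  r_state : nat;
  r_read  : list sym;
  r_next  : nat;
  r_write : list sym;
  r_move  : list mv }.

Record TM := mkTM {
  tm_nin   : nat;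
  tm_nwork : nat;
  tm_rules : list rule;
  tm_start : nat;
  tm_acc   : nat;
  tm_rej   : nat }.

Definition tm_wf (M : TM) : Prop :=
  tm_acc M <> tm_rej M /\
  forall r, In r (tm_rules M) ->
    length (r_read r) = tm_nin M + tm_nwork M /\
    length (r_write r) = tm_nwork M /\
    length (r_move r) = tm_nin M + tm_nwork M.

Record config := mkConfig {
  c_state : nat;
  c_inpos : list Z;
  c_work  : list ((Z -> sym) * Z) }.

Definition bit_sym (b : bool) : sym := if b then S1 else S0.

Definition read_in (w : list bool) (pos : Z) : sym :=
  if (0 <=? pos)%Z && (pos <? Z.of_nat (length w))%Z
  then bit_sym (nth (Z.to_nat pos) w false) else SB.

Definition move_head (m : mv) (p : Z) : Z :=
  match m with ML => (p - 1)%Z | MR => (p + 1)%Z | MS => p end.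

Definition init_config (M : TM) (ins : list (list bool)) : config :=
  mkConfig (tm_start M) (repeat 0%Z (tm_nin M))
           (repeat ((fun _ => SB), 0%Z) (tm_nwork M)).

Definition cur_reads (ins : list (list bool)) (cf : config) : list sym :=
  map (fun '(w, p) => read_in w p) (combine ins (c_inpos cf)) ++
  map (fun '(t, p) => t p) (c_work cf).

Definition find_rule (M : TM) (ins : list (list bool)) (cf : config) : option rule :=
  find (fun r => Nat.eqb (r_state r) (c_state cf) && syms_eqb (r_read r) (cur_reads ins cf))
       (tm_rules M).

Definition is_final (M : TM) (q : nat) : bool :=
  Nat.eqb q (tm_acc M) || Nat.eqb q (tm_rej M).

Definition write_move (t : (Z -> sym) * Z) (s : sym) (m : mv) : (Z -> sym) * Z :=
  let '(tape, p) := t in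
  (fun z => if Z.eqb z p then s else tape z, move_head m p).

Definition apply_rule (M : TM) (r : rule) (cf : config) : config :=
  let mvin := firstn (tm_nin M) (r_move r) in
  let mvw := skipn (tm_nin M) (r_move r) in
  mkConfig (r_next r)
    (map (fun '(m, p) => move_head m p) (combine mvin (c_inpos cf)))
    (map (fun '(t, sm) => write_move t (fst sm) (snd sm))
         (combine (c_work cf) (combine (r_write r) mvw))).

(* A configuration is halted if the state is final or no rule applies
   (the latter is an "invalid" halt, whose output is bot). *)
Definition halted (M : TM) (ins : list (list bool)) (cf : config) : Prop :=
  is_final M (c_state cf) = true \/ find_rule M ins cf = None.

Definition step (M : TM) (ins : list (list bool)) (cf : config) : config :=
  if is_final M (c_state cf) then cf
  else match find_rule M ins cf with
       | Some r => apply_rule M r cf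
       | None => cf
       end.

Definition run (M : TM) (ins : list (list bool)) (t : nat) : config :=
  Nat.iter t (step M ins) (init_config M ins).

Definition res (M : TM) (cf : config) : option bool :=
  if Nat.eqb (c_state cf) (tm_acc M) then Some true
  else if Nat.eqb (c_state cf) (tm_rej M) then Some false
  else None.

Definition tm_output (M : TM) (ins : list (list bool)) (o : option bool) : Prop :=
  match o with
  | Some true  => exists t, c_state (run M ins t) = tm_acc M
  | Some false => exists t, c_state (run M ins t) = tm_rej M
  | None => forall t, c_state (run M ins t) <> tm_acc M /\
                      c_state (run M ins t) <> tm_rej M
  end.

(* An interpreter, as the (functional) relation phi(h,x) = o. *)
Definition interp := list bool -> list bool -> option bool -> Prop.

Definition computes (phi : interp) (n : nat) (f : list bool -> bool) (h : list bool) : Prop :=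
  forall x, length x = n -> phi h x (Some (f x)).

Definition desc_len (phi : interp) (n : nat) (f : list bool -> bool) (k : nat) : Prop :=
  (exists h, length h = k /\ computes phi n f h) /\
  (forall h, computes phi n f h -> k <= length h).

Definition tm_interp (U : TM) : interp := fun p x o => tm_output U [p; x] o.

Definition prefix_free_encoding (E : TM -> list bool) : Prop :=
  (forall T, 2 <= length (E T)) /\
  (forall T T' u, E T ++ u = E T' -> T = T').

Definition two_input (T : TM) : Prop := tm_wf T /\ tm_nin T = 2.

Definition valid_prog (E : TM -> list bool) (p : list bool) : Prop :=
  exists T u, two_input T /\ p = E T ++ u.

Definition universal_interp (c : nat) (E : TM -> list bool) (U : TM) : Prop :=
  tm_wf U /\ tm_nin U = 2 /\ tm_nwork U = 3 /\
  (exists beta : nat, forall p x, 1 <= length x ->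
       halted U [p; x] (run U [p; x] (beta * length x ^ c))) /\
  (forall p x, 1 <= length x -> ~ valid_prog E p -> tm_output U [p; x] None) /\
  (* on E(T)u: bot (check not finished), 0 (simulation budget exhausted),
     or T's output, T having halted within the budget of n^c steps *)
  (forall T u x, 1 <= length x -> two_input T ->
     tm_output U [E T ++ u; x] None \/
     tm_output U [E T ++ u; x] (Some false) \/
     (exists t, t <= length x ^ c /\ halted T [u; x] (run T [u; x] t) /\
                tm_output U [E T ++ u; x] (res T (run T [u; x] t)))) /\
  (* efficient (Hennie-Stearns, O(t log t)) simulation: for each T there is
     a constant K such that T's output is returned whenever T halts within t
     steps with K (t log t + 1) <= n^c *)
  (forall T, two_input T -> exists K : nat, forall u x t, 1 <= length x ->
     halted T [u; x] (run T [u; x] t) ->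
     K * (t * (Nat.log2_up t + 1) + 1) <= length x ^ c ->
     tm_output U [E T ++ u; x] (res T (run T [u; x] t))).

(* Vertices listed in topological order; parents are indices of earlier
   vertices (0-based); sources carry an input index in {1..n}. The last
   vertex is the output (sink). *)
Inductive vertex :=
  | VIn (i : nat)
  | VAnd (a b : nat)
  | VOr (a b : nat)
  | VNot (a : nat).

Definition parents (v : vertex) : list nat :=
  match v with
  | VIn _ => []
  | VAnd a b | VOr a b => [a; b]
  | VNot a => [a]
  end.

Definition vertex_ok (n k : nat) (v : vertex) : Prop :=
  match v with
  | VIn i => 1 <= i <= n
  | _ => forall a, In a (parents v) -> a < k
  end.

(* a DAG with unique sink (the last vertex) *)
Definition circuit_ok (n : nat) (C : list vertex) : Prop :=
  C <> [] /\
  (forall k, k < length C -> vertex_ok n k (nth k C (VIn 0))) /\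
  (forall k, k + 1 < length C ->
     exists j, k < j < length C /\ In k (parents (nth j C (VIn 0)))).

Definition eval_vertex (x : list bool) (vals : list bool) (v : vertex) : bool :=
  match v with
  | VIn i => nth (i - 1) x false
  | VAnd a b => nth a vals false && nth b vals false
  | VOr a b => nth a vals false || nth b vals false
  | VNot a => negb (nth a vals false)
  end.

Definition circuit_vals (x : list bool) (C : list vertex) : list bool :=
  fold_left (fun vals v => vals ++ [eval_vertex x vals v]) C [].

Definition circuit_out (x : list bool) (C : list vertex) : bool :=
  last (circuit_vals x C) false.

Definition circ_enc_len (s n : nat) : nat :=
  2 * Nat.log2_up n + 2 + s * (3 + Nat.max (2 * Nat.log2_up s) (Nat.log2_up n)).

Definition circ_desc_len (n : nat) (f : list bool -> bool) (k : nat) : Prop :=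
  (exists C, circuit_ok n C /\ (forall x, length x = n -> circuit_out x C = f x) /\
             circ_enc_len (length C) n = k) /\
  (forall C, circuit_ok n C -> (forall x, length x = n -> circuit_out x C = f x) ->
             k <= circ_enc_len (length C) n).

Definition log2R (x : R) : R := (ln x / ln 2)%R.

(* sup { |f|_C / |f|_U : f in H^n, |f|_U < oo } <= B  (sup of a finite set,
   unfolded: every ratio in the set is <= B; an infinite |f|_C counts as an
   unbounded ratio, hence must not occur). *)
Definition sup_ratio_le (E : TM -> list bool) (U : TM) (n : nat) (B : R) : Prop :=
  forall (f : list bool -> bool) (kU : nat),
    desc_len (tm_interp U) n f kU ->
    exists kC, circ_desc_len n f kC /\ (INR kC / INR kU <= B)%R.

(* Main.v *)
(** A machine running for 2^k steps is simulated by a circuit with O(k 2^k)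
    vertices.  For each tape keep a window of three blocks of 2^k cells with the
    head starting in the middle block.  To run 2^(k+1) steps, cut the window into
    six blocks of 2^k cells, select by multiplexers the three blocks around the
    head, run 2^k steps on them recursively, write them back, and do the same
    once more.  The multiplexers cost O(2^k) because the selection is only
    between four block offsets; the exact head position is carried by a marker
    bit in each cell.  Applied to the universal interpreter, with the program
    hard-wired and 2^k of order n^c, this gives circuits with O(n^c log n)
    vertices, that is O(n^c log^2 n) bits, for every f with a program; the
    ratio is at most this length, because the program is nonempty or the
    quotient is the junk value 0. *)

Require Import Defs.
From Stdlib Require Import Bool List ZArith Arith Lia Reals Lra.
From Stdlib Require Import Classical FunctionalExtensionality.
Import ListNotations.

(** * Circuits as derivations of Boolean functions *)

(** The part of [circuit_ok] that survives appending vertices. The unique sink is restored only at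
    the end, by [available_circuit]. *)
Definition wf_circuit (n : nat) (C : list vertex) : Prop :=
  forall k, k < length C -> vertex_ok n k (nth k C (VIn 0)).

Lemma circuit_vals_snoc x C v :
  circuit_vals x (C ++ [v]) =
  circuit_vals x C ++ [eval_vertex x (circuit_vals x C) v].
Proof. unfold circuit_vals; now rewrite fold_left_app. Qed.

Lemma circuit_vals_length x C : length (circuit_vals x C) = length C.
Proof.
  induction C as [|v C IH] using rev_ind; [reflexivity|].
  rewrite circuit_vals_snoc, !length_app, IH; reflexivity.
Qed.

Lemma circuit_vals_app_nth x C D k :
  k < length C ->
  nth k (circuit_vals x (C ++ D)) false = nth k (circuit_vals x C) false.
Proof.
  intros Hk; induction D as [|v D IH] using rev_ind; [now rewrite app_nil_r|].
  rewrite app_assoc, circuit_vals_snoc, app_nth1; [exact IH|].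
  rewrite circuit_vals_length, length_app; lia.
Qed.

Lemma circuit_vals_nth_snoc x C v :
  nth (length C) (circuit_vals x (C ++ [v])) false =
  eval_vertex x (circuit_vals x C) v.
Proof.
  rewrite circuit_vals_snoc, app_nth2; rewrite circuit_vals_length; [|lia].
  now rewrite Nat.sub_diag.
Qed.

Lemma wf_circuit_snoc n C v :
  wf_circuit n C -> vertex_ok n (length C) v -> wf_circuit n (C ++ [v]).
Proof.
  intros HC Hv k; rewrite length_app; simpl; intros Hk.
  destruct (Nat.eq_dec k (length C)) as [->|Hne].
  - now rewrite nth_middle.
  - rewrite app_nth1 by lia; apply HC; lia.
Qed.

Definition available (n : nat) (C : list vertex) (g : list bool -> bool) : Prop :=
  exists k, k < length C /\
    forall x, length x = n -> nth k (circuit_vals x C) false = g x.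

Lemma available_app n C D g : available n C g -> available n (C ++ D) g.
Proof.
  intros (k & Hk & H); exists k; rewrite length_app; split; [lia|].
  intros x Hx; rewrite circuit_vals_app_nth by exact Hk; auto.
Qed.

Lemma available_snoc n C v g :
  (forall x, length x = n -> eval_vertex x (circuit_vals x C) v = g x) ->
  available n (C ++ [v]) g.
Proof.
  intros H; exists (length C); rewrite length_app; simpl; split; [lia|].
  intros x Hx; rewrite circuit_vals_nth_snoc; auto.
Qed.

(* Speaking of functions rather than of vertices makes rearranging and
   duplicating wires free. *)
Definition derives (n s : nat) (A B : list (list bool -> bool)) : Prop :=
  forall C, wf_circuit n C -> (forall g, In g A -> available n C g) ->
  exists D, length D <= s /\ wf_circuit n (C ++ D) /\
    forall g, In g B -> available n (C ++ D) g.

Lemma derives_weaken n s s' A A' B B' :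
  derives n s A B -> s <= s' -> incl A A' -> incl B' B -> derives n s' A' B'.
Proof.
  intros H Hs HA HB C HC Hav.
  destruct (H C HC) as (D & HD & Hwf & HBv); [auto|].
  exists D; repeat split; auto; lia.
Qed.

Lemma derives_incl n A B : incl B A -> derives n 0 A B.
Proof.
  intros H C HC Hav; exists []; rewrite app_nil_r; repeat split; auto.
Qed.

Lemma derives_ext n s A g g' :
  derives n s A [g] -> (forall x, length x = n -> g x = g' x) ->
  derives n s A [g'].
Proof.
  intros H Hg C HC Hav; destruct (H C HC Hav) as (D & HD & Hwf & HB).
  exists D; repeat split; auto.
  intros g0 [<-|[]]; destruct (HB g (or_introl eq_refl)) as (k & Hk & He).
  exists k; split; auto; intros x Hx; rewrite <- Hg; auto.
Qed.

Lemma derives_trans n s t A B B' :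
  derives n s A B -> derives n t B B' -> derives n (s + t) A B'.
Proof.
  intros H1 H2 C HC Hav; destruct (H1 C HC Hav) as (D & HD & Hwf & HB).
  destruct (H2 _ Hwf HB) as (D' & HD' & Hwf' & HB').
  exists (D ++ D'); rewrite app_assoc, length_app; repeat split; auto; lia.
Qed.

Lemma derives_keep n s A B : derives n s A B -> derives n s A (A ++ B).
Proof.
  intros H C HC Hav; destruct (H C HC Hav) as (D & HD & Hwf & HB).
  exists D; repeat split; auto.
  intros g Hg; apply in_app_or in Hg as [Hg|Hg]; auto using available_app.
Qed.

Lemma derives_app n s t A B B' :
  derives n s A B -> derives n t A B' -> derives n (s + t) A (B ++ B').
Proof.
  intros H1 H2 C HC Hav; destruct (H1 C HC Hav) as (D & HD & Hwf & HB).
  destruct (H2 _ Hwf) as (D' & HD' & Hwf' & HB'); [auto using available_app|].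
  exists (D ++ D'); rewrite app_assoc, length_app; repeat split; auto; try lia.
  intros g Hg; apply in_app_or in Hg as [Hg|Hg]; auto using available_app.
Qed.

Lemma derives_each n r A B :
  (forall g, In g B -> derives n r A [g]) -> derives n (r * length B) A B.
Proof.
  induction B as [|g B IH]; intros H.
  - apply derives_weaken with 0 A []; try lia; auto using incl_refl.
    apply derives_incl, incl_nil_l.
  - replace (r * length (g :: B)) with (r + r * length B) by (simpl; lia).
    apply (derives_app n r _ A [g] B); [apply H; now left|].
    apply IH; intros; apply H; now right.
Qed.

Lemma derives_in n A g : In g A -> derives n 0 A [g].
Proof. intros H; apply derives_incl; intros ? [<-|[]]; exact H. Qed.

(** * Gates, constants and multiplexers *)

Lemma derives_input n A i :
  i < n -> derives n 1 A [fun x => nth i x false].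
Proof.
  intros Hi C HC _; exists [VIn (S i)]; split; [auto|split].
  - apply wf_circuit_snoc; simpl; auto; lia.
  - intros g [<-|[]]; apply available_snoc; intros x _; simpl.
    now rewrite Nat.sub_0_r.
Qed.

Lemma derives_negb n s A f :
  derives n s A [f] -> derives n (s + 1) A [fun x => negb (f x)].
Proof.
  intros H; apply derives_trans with [f]; [exact H|].
  intros C HC Hav; destruct (Hav f) as (k & Hk & He); [now left|].
  exists [VNot k]; split; [auto|split].
  - apply wf_circuit_snoc; auto; intros a [<-|[]]; lia.
  - intros g [<-|[]]; apply available_snoc; intros x Hx; simpl.
    now rewrite He.
Qed.

Lemma derives_andb n s t A f g :
  derives n s A [f] -> derives n t A [g] ->
  derives n (s + t + 1) A [fun x => f x && g x].
Proof.
  intros H1 H2; apply derives_trans with ([f] ++ [g]);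
    [now apply derives_app|].
  intros C HC Hav; destruct (Hav f) as (k & Hk & He); [now left|].
  destruct (Hav g) as (l & Hl & He'); [now right; left|].
  exists [VAnd k l]; split; [auto|split].
  - apply wf_circuit_snoc; auto; intros a [<-|[<-|[]]]; lia.
  - intros g0 [<-|[]]; apply available_snoc; intros x Hx; simpl.
    now rewrite He, He'.
Qed.

Lemma derives_orb n s t A f g :
  derives n s A [f] -> derives n t A [g] ->
  derives n (s + t + 1) A [fun x => f x || g x].
Proof.
  intros H1 H2; apply derives_trans with ([f] ++ [g]);
    [now apply derives_app|].
  intros C HC Hav; destruct (Hav f) as (k & Hk & He); [now left|].
  destruct (Hav g) as (l & Hl & He'); [now right; left|].
  exists [VOr k l]; split; [auto|split].
  - apply wf_circuit_snoc; auto; intros a [<-|[<-|[]]]; lia.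
  - intros g0 [<-|[]]; apply available_snoc; intros x Hx; simpl.
    now rewrite He, He'.
Qed.

(** Constants come from the first input as [y OR NOT y] or [y AND NOT y], hence [1 <= n]; the input
    vertex is made twice, so there are four vertices. *)
Lemma derives_const n A b : 1 <= n -> derives n 4 A [fun _ => b].
Proof.
  intros Hn; pose proof (derives_input n A 0 Hn) as H.
  destruct b.
  - eapply derives_ext; [exact (derives_orb _ _ _ _ _ _ H (derives_negb _ _ _ _ H))|].
    intros x _; simpl; apply orb_negb_r.
  - eapply derives_ext; [exact (derives_andb _ _ _ _ _ _ H (derives_negb _ _ _ _ H))|].
    intros x _; simpl; apply andb_negb_r.
Qed.

Lemma derives_existsb n {T} (l : list T) r A (P : T -> list bool -> bool) :
  1 <= n -> (forall t, In t l -> derives n r A [P t]) ->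
  derives n (length l * (r + 1) + 4) A [fun x => existsb (fun t => P t x) l].
Proof.
  intros Hn; induction l as [|t l IH]; intros H; simpl.
  - now apply derives_const.
  - apply derives_weaken with
      (s := r + (length l * (r + 1) + 4) + 1) (A := A)
      (B := [fun x => P t x || existsb (fun t => P t x) l]);
      auto using incl_refl; [|lia].
    apply derives_orb; [apply H; now left|].
    apply IH; intros; apply H; now right.
Qed.

(** A multiplexer: [P (v x) x] is the disjunction over the possible values [t] of [v x = t] AND
    [P t x]. Here [r] pays for a selector and [r'] for a branch. *)
Lemma derives_switch n {T} (eqb : T -> T -> bool) (l : list T)
      (v : list bool -> T) r r' A (P : T -> list bool -> bool) :
  1 <= n -> (forall a b, eqb a b = true <-> a = b) ->
  (forall x, In (v x) l) ->
  (forall t, In t l -> derives n r A [fun x => eqb (v x) t]) ->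
  (forall t, In t l -> derives n r' A [P t]) ->
  derives n (length l * (r + r' + 2) + 4) A [fun x => P (v x) x].
Proof.
  intros Hn Heqb Hv Hsel HP.
  replace (r + r' + 2) with (r + r' + 1 + 1) by lia.
  eapply derives_ext.
  - apply (derives_existsb n l (r + r' + 1) A
             (fun t x => eqb (v x) t && P t x) Hn).
    intros t Ht; apply derives_andb; auto.
  - intros x _; simpl; apply eq_true_iff_eq; rewrite existsb_exists; split.
    + intros (t & _ & Ht); apply andb_prop in Ht as [Ht HPt].
      apply Heqb in Ht; now rewrite Ht.
    + intros H; exists (v x); split; [apply Hv|].
      rewrite H, andb_true_r; now apply Heqb.
Qed.

(* Each vertex [v] gets the successor [NOT v]; the vertices [v AND NOT v],
   constantly false, are then merged by ORs into the output, so that the last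
   vertex becomes the only sink. *)
Lemma available_circuit n C g :
  wf_circuit n C -> available n C g ->
  exists C', circuit_ok n C' /\ length C' <= 4 * length C /\
    forall x, length x = n -> circuit_out x C' = g x.
Proof.
  intros HC Hg.
  (* After [m] rounds of three vertices each, the only possible sinks are the original vertices from
     index [m] on and the last vertex, which computes [g]. *)
  assert (forall m, 1 <= m <= length C -> exists C',
    wf_circuit n C' /\ length C' = length C + 3 * m /\
    (forall x, length x = n -> nth (length C' - 1) (circuit_vals x C') false = g x) /\
    (forall k, k < m \/ length C <= k -> k + 1 < length C' ->
       exists j, k < j < length C' /\ In k (parents (nth j C' (VIn 0))))) as H.
  { intros m; induction m as [|m IH]; intros Hm; [lia|].
    (* [o] is the current output: any vertex of [C] computing [g] before the first round, the last
       vertex afterwards. *)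
    assert (exists C0 o, wf_circuit n C0 /\ length C0 = length C + 3 * m /\
       o < length C0 /\ (m = 0 \/ o + 1 = length C0) /\
       (forall x, length x = n -> nth o (circuit_vals x C0) false = g x) /\
       (forall k, k < m \/ length C <= k -> k + 1 < length C0 ->
       exists j, k < j < length C0 /\ In k (parents (nth j C0 (VIn 0)))))
      as (C0 & o & Hwf & Hlen & Ho & Hol & Hval & Hsink).
    { destruct m as [|m].
      - destruct Hg as (o & Ho & He); exists C, o.
        repeat split; auto; try lia.
      - destruct IH as (C0 & H1 & H2 & H3 & H4); [lia|].
        exists C0, (length C0 - 1); repeat split; auto; lia. }
    exists (((C0 ++ [VNot m]) ++ [VAnd m (length C0)]) ++ [VOr o (S (length C0))]).
    repeat split.
    - apply wf_circuit_snoc; [apply wf_circuit_snoc; [apply wf_circuit_snoc|]|];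
        auto; rewrite ?length_app; simpl; lia.
    - rewrite !length_app; simpl; lia.
    - intros x Hx.
      rewrite length_app, Nat.add_sub, circuit_vals_nth_snoc; simpl.
      replace (S (length C0)) with (length (C0 ++ [VNot m])) at 1
        by (rewrite length_app; simpl; lia).
      rewrite circuit_vals_nth_snoc; simpl.
      rewrite circuit_vals_nth_snoc; simpl.
      rewrite <- !app_assoc, !circuit_vals_app_nth by lia.
      rewrite andb_negb_r, orb_false_r; auto.
    - intros k Hk; rewrite !length_app; simpl; intros Hk'.
      assert (forall j, j < length C0 ->
        nth j (((C0 ++ [VNot m]) ++ [VAnd m (length C0)]) ++
                 [VOr o (S (length C0))]) (VIn 0) = nth j C0 (VIn 0)) as Hnth.
      { intros j Hj; rewrite <- !app_assoc; now apply app_nth1. }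
      assert (forall d, nth (length C0 + d) (((C0 ++ [VNot m]) ++
        [VAnd m (length C0)]) ++ [VOr o (S (length C0))]) (VIn 0) =
        nth d [VNot m; VAnd m (length C0); VOr o (S (length C0))] (VIn 0))
        as Hnth'.
      { intros d; rewrite <- !app_assoc, app_nth2 by lia.
        now rewrite Nat.add_comm, Nat.add_sub. }
      destruct (Nat.eq_dec k m) as [->|Hne].
      { exists (length C0 + 0); rewrite Hnth'; simpl; split; [lia|auto]. }
      destruct (Nat.lt_ge_cases (k + 1) (length C0)) as [Hlt|Hge].
      { destruct (Hsink k) as (j & Hj & Hin); [lia|lia|].
        exists j; rewrite Hnth by lia; split; [lia|auto]. }
      destruct (Nat.eq_dec k (length C0)) as [->|Hne'].
      { exists (length C0 + 1); rewrite Hnth'; simpl; split; [lia|auto]. }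
      (* Only the previous output and the new AND remain, and both are parents of the new OR. *)
      exists (length C0 + 2); rewrite Hnth'; simpl; split; lia. }
  destruct (H (length C)) as (C' & Hwf & Hlen & Hval & Hsink).
  { destruct Hg as (k & Hk & _); lia. }
  exists C'; split; [|split; [lia|]].
  - split; [|split; [exact Hwf|]].
    + intros ->; destruct Hg as (k & Hk & _); simpl in Hlen; lia.
    + intros k Hk; apply Hsink; lia.
  - intros x Hx; unfold circuit_out; rewrite <- (Hval x Hx).
    destruct (exists_last (l := circuit_vals x C')) as (l & b & El).
    { intros E; apply (f_equal (@length _)) in E.
      rewrite circuit_vals_length in E; simpl in E.
      destruct Hg as (k & Hk & _); lia. }
    pose proof (circuit_vals_length x C') as HL; rewrite El in *.
    rewrite last_last; rewrite length_app in HL; simpl in HL.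
    rewrite <- HL, Nat.add_sub; now rewrite nth_middle.
Qed.

(** * Circuits simulating a multi-tape machine *)

(** Input and work tapes are treated alike: a read-only tape is one whose scanned symbol is always
    written back. *)
Record tapes_config := TapesConfig {
  tc_state : nat;
  tc_cell  : nat -> Z -> sym;
  tc_head  : nat -> Z }.

Lemma sym_eqb_eq a b : sym_eqb a b = true <-> a = b.
Proof. destruct a, b; simpl; split; congruence. Qed.

Lemma in_all_syms s : In s [S0; S1; SB].
Proof. destruct s; simpl; auto. Qed.

Section Simulation.

Context (ntapes nstates : nat).
Context (delta : nat -> list sym -> nat * (nat -> sym * mv)).
Context (delta_state : forall q r, q < nstates -> fst (delta q r) < nstates).

Definition tc_reads (c : tapes_config) : list sym :=
  map (fun j => tc_cell c j (tc_head c j)) (seq 0 ntapes).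

Definition tc_delta (c : tapes_config) : nat * (nat -> sym * mv) :=
  delta (tc_state c) (tc_reads c).

Definition tc_step (c : tapes_config) : tapes_config :=
  TapesConfig (fst (tc_delta c))
    (fun j z => if Z.eqb z (tc_head c j) then fst (snd (tc_delta c) j)
                else tc_cell c j z)
    (fun j => move_head (snd (snd (tc_delta c) j)) (tc_head c j)).

Definition tc_run (t : nat) (c : tapes_config) : tapes_config :=
  Nat.iter t tc_step c.

Lemma tc_run_state t c :
  tc_state c < nstates -> tc_state (tc_run t c) < nstates.
Proof.
  intros H; induction t as [|t IH]; [exact H|]; simpl.
  now apply delta_state.
Qed.

Lemma tc_run_head t c j :
  (Z.abs (tc_head (tc_run t c) j - tc_head c j) <= Z.of_nat t)%Z.
Proof.
  induction t as [|t IH]; [simpl; lia|].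
  change (tc_run (S t) c) with (tc_step (tc_run t c)); simpl tc_head.
  unfold move_head; destruct (snd (snd (tc_delta (tc_run t c)) j)); lia.
Qed.

(** The last write precedes the last move, so [t] steps write only at distance less than [t] from
    the starting head position. *)
Lemma tc_run_cell t c j z :
  (Z.of_nat t <= Z.abs (z - tc_head c j))%Z ->
  tc_cell (tc_run t c) j z = tc_cell c j z.
Proof.
  induction t as [|t IH]; intros Hz; [reflexivity|].
  change (tc_run (S t) c) with (tc_step (tc_run t c)); simpl tc_cell.
  pose proof (tc_run_head t c j).
  destruct (Z.eqb_spec z (tc_head (tc_run t c) j)); [lia|apply IH; lia].
Qed.

(* [Some s]: the cell contains [s]; [None]: the head is on the cell. *)
Definition cell_bit (c : tapes_config) (j : nat) (k : option sym) (z : Z) : bool :=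
  match k with
  | Some s => sym_eqb (tc_cell c j z) s
  | None => Z.eqb (tc_head c j) z
  end.

Definition cell_kinds : list (option sym) := [Some S0; Some S1; Some SB; None].

Lemma in_cell_kinds k : In k cell_kinds.
Proof. destruct k as [[]|]; simpl; auto. Qed.

(* The [w] cells of tape [j] starting at [base x j].  The base may depend on
   the input [x] of the circuit: moving it only has to be paid for by
   multiplexing. *)
Definition window (w : nat) (c : list bool -> tapes_config)
    (base : list bool -> nat -> Z) : list (list bool -> bool) :=
  map (fun i x => Nat.eqb (tc_state (c x)) i) (seq 0 nstates) ++
  flat_map (fun j => flat_map (fun i => map (fun k x =>
      cell_bit (c x) j k (base x j + Z.of_nat i)) cell_kinds) (seq 0 w))
    (seq 0 ntapes).

Definition window_size (w : nat) : nat := nstates + ntapes * (w * 4).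

Lemma length_flat_map_const {T U} (f : T -> list U) l m :
  (forall t, length (f t) = m) -> length (flat_map f l) = length l * m.
Proof.
  intros H; induction l as [|t l IH]; simpl; [reflexivity|].
  now rewrite length_app, H, IH.
Qed.

Lemma window_length w c base : length (window w c base) = window_size w.
Proof.
  unfold window, window_size; rewrite length_app, length_map, length_seq.
  erewrite length_flat_map_const; [now rewrite length_seq|].
  intros j; erewrite length_flat_map_const; [now rewrite length_seq|].
  reflexivity.
Qed.

Lemma window_state w c base i :
  i < nstates -> In (fun x => Nat.eqb (tc_state (c x)) i) (window w c base).
Proof.
  intros Hi; apply in_or_app; left.
  apply (in_map (fun i x => Nat.eqb (tc_state (c x)) i)), in_seq; lia.
Qed.

Lemma window_cell w c base j k i :
  j < ntapes -> i < w ->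
  In (fun x => cell_bit (c x) j k (base x j + Z.of_nat i)%Z) (window w c base).
Proof.
  intros Hj Hi; apply in_or_app; right.
  apply in_flat_map; exists j; split; [apply in_seq; lia|].
  apply in_flat_map; exists i; split; [apply in_seq; lia|].
  apply (in_map (fun k x => cell_bit (c x) j k (base x j + Z.of_nat i)%Z)).
  apply in_cell_kinds.
Qed.

Lemma derives_window n r A w c base :
  (forall i, i < nstates ->
     derives n r A [fun x => Nat.eqb (tc_state (c x)) i]) ->
  (forall j k i, j < ntapes -> i < w ->
     derives n r A [fun x => cell_bit (c x) j k (base x j + Z.of_nat i)%Z]) ->
  derives n (r * window_size w) A (window w c base).
Proof.
  intros Hs Hc; rewrite <- (window_length w c base); apply derives_each.
  intros g Hg; apply in_app_or in Hg as [Hg|Hg].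
  - apply in_map_iff in Hg as (i & <- & Hi); apply in_seq in Hi; apply Hs; lia.
  - apply in_flat_map in Hg as (j & Hj & Hg); apply in_seq in Hj.
    apply in_flat_map in Hg as (i & Hi & Hg); apply in_seq in Hi.
    apply in_map_iff in Hg as (k & <- & _); apply Hc; lia.
Qed.

(** * One step as a circuit, and its recursive doubling *)

Context (n : nat) (n_pos : 1 <= n).

Fixpoint reads_cost (k : nat) : nat :=
  match k with 0 => 4 | S k => 3 * (0 + reads_cost k + 2) + 4 end.

(** Switching on one symbol after another leaves a constant at each leaf. The cost depends only on
    the number of symbols, whatever [P] is, so a transition table can be hard-wired. *)
Lemma derives_of_symbols A (rs : list (list bool -> sym)) :
  (forall r s, In r rs -> In (fun x => sym_eqb (r x) s) A) ->
  forall P : list sym -> bool,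
  derives n (reads_cost (length rs)) A [fun x => P (map (fun r => r x) rs)].
Proof.
  induction rs as [|r rs IH]; intros H P; simpl length; simpl reads_cost.
  - simpl; now apply derives_const.
  - apply (derives_switch n sym_eqb [S0; S1; SB] r 0 (reads_cost (length rs)) A
      (fun s x => P (s :: map (fun r => r x) rs)) n_pos sym_eqb_eq).
    + intros x; apply in_all_syms.
    + intros s _; apply derives_in, H; now left.
    + intros s _; apply (IH (fun r s' Hr => H r s' (or_intror Hr))
        (fun l => P (s :: l))).
Qed.

Definition local_cost : nat := nstates * (0 + reads_cost ntapes + 2) + 4.

Lemma derives_local A c (P : nat -> list sym -> bool) :
  (forall x, tc_state (c x) < nstates) ->
  (forall i, i < nstates -> In (fun x => Nat.eqb (tc_state (c x)) i) A) ->
  (forall j s, j < ntapes ->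
     derives n 0 A [fun x => sym_eqb (tc_cell (c x) j (tc_head (c x) j)) s]) ->
  derives n local_cost A [fun x => P (tc_state (c x)) (tc_reads (c x))].
Proof.
  intros Hc HA HA'.
  replace local_cost with
    (length (seq 0 nstates) * (0 + reads_cost ntapes + 2) + 4)
    by (now rewrite length_seq).
  apply (derives_switch n Nat.eqb (seq 0 nstates) (fun x => tc_state (c x))
    0 (reads_cost ntapes) A (fun q x => P q (tc_reads (c x))) n_pos Nat.eqb_eq).
  - intros x; apply in_seq; specialize (Hc x); lia.
  - intros i Hi; apply in_seq in Hi; apply derives_in, HA; lia.
  - intros q _.
    set (rs := map (fun j x => tc_cell (c x) j (tc_head (c x) j)) (seq 0 ntapes)).
    set (A' := flat_map (fun j => map (fun s x =>
       sym_eqb (tc_cell (c x) j (tc_head (c x) j)) s) [S0; S1; SB]) (seq 0 ntapes)).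
    change (reads_cost ntapes) with (0 + reads_cost ntapes).
    apply derives_trans with A'.
    + change 0 with (0 * length A'); apply derives_each; intros g Hg.
      apply in_flat_map in Hg as (j & Hj & Hg); apply in_seq in Hj.
      apply in_map_iff in Hg as (s & <- & _); apply HA'; lia.
    + replace (reads_cost ntapes) with (reads_cost (length rs))
        by (unfold rs; now rewrite length_map, length_seq).
      eapply derives_ext; [apply (derives_of_symbols A' rs) with (P := P q)|].
      * intros r s Hr; apply in_map_iff in Hr as (j & <- & Hj).
        apply in_flat_map; exists j; split; [exact Hj|].
        apply (in_map (fun s x => sym_eqb (tc_cell (c x) j (tc_head (c x) j)) s)).
        apply in_all_syms.
      * intros x _; unfold rs, tc_reads; now rewrite map_map.
Qed.

(** With blocks of one cell the head is known to be on cell 1 of the window, so the scanned symbols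
    are wires already present and every new bit is a function of the state and these symbols, or an
    old bit. *)
Lemma derives_step c base :
  (forall x, tc_state (c x) < nstates) ->
  (forall x j, j < ntapes -> tc_head (c x) j = (base x j + 1)%Z) ->
  derives n (local_cost * window_size 3) (window 3 c base)
    (window 3 (fun x => tc_step (c x)) base).
Proof.
  intros Hq Hh.
  assert (forall P, derives n local_cost (window 3 c base)
    [fun x => P (tc_state (c x)) (tc_reads (c x))]) as Hloc.
  { intros P; apply derives_local; auto using window_state.
    intros j s Hj.
    eapply derives_ext;
      [apply derives_in, (window_cell 3 c base j (Some s) 1); lia|].
    intros x _; simpl; now rewrite Hh. }
  apply derives_window.
  - intros i Hi; apply (Hloc (fun q r => Nat.eqb (fst (delta q r)) i)).
  - intros j [s|] i Hj Hi.
    + destruct (Nat.eq_dec i 1) as [->|Hi1].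
      * eapply derives_ext;
          [apply (Hloc (fun q r => sym_eqb (fst (snd (delta q r) j)) s))|].
        intros x _; simpl; rewrite Hh by exact Hj; now rewrite Z.eqb_refl.
      * apply derives_weaken with 0 (window 3 c base)
          [fun x => cell_bit (tc_step (c x)) j (Some s) (base x j + Z.of_nat i)%Z];
          auto using incl_refl; [|lia].
        eapply derives_ext;
          [apply derives_in, (window_cell 3 c base j (Some s) i); lia|].
        intros x _; simpl; rewrite Hh by exact Hj.
        destruct (Z.eqb_spec (base x j + Z.of_nat i) (base x j + 1)); [lia|reflexivity].
    + eapply derives_ext;
        [apply (Hloc (fun q r => Z.eqb (move_head (snd (snd (delta q r) j)) 1)
                                   (Z.of_nat i)))|].
      intros x _; simpl; unfold tc_delta; rewrite Hh by exact Hj.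
      apply eq_true_iff_eq; rewrite !Z.eqb_eq; unfold move_head.
      destruct (snd (snd (delta _ _) j)); lia.
Qed.

(** The first summand pays for locating the heads, by [4 * (h + 4) <= 20 * h] for each tape; the
    second bounds the multiplexing in and out, at 12 vertices per bit. *)
Definition half_cost : nat := 20 * ntapes + 24 * (2 * nstates + 36 * ntapes).

(* The six blocks of [h] cells are numbered from 0.  When the head is in block
   [o] with [1 <= o <= 4], blocks [o-1], [o], [o+1] contain everything [h]
   steps can touch: multiplex them out, simulate, and multiplex them back. *)
Lemma derives_half h s :
  1 <= h ->
  (forall c base,
     (forall x, tc_state (c x) < nstates) ->
     (forall x j, j < ntapes ->
        (base x j + Z.of_nat h <= tc_head (c x) j
         < base x j + Z.of_nat (2 * h))%Z) ->
     derives n s (window (3 * h) c base)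
       (window (3 * h) (fun x => tc_run h (c x)) base)) ->
  forall c base,
  (forall x, tc_state (c x) < nstates) ->
  (forall x j, j < ntapes ->
     (base x j + Z.of_nat h <= tc_head (c x) j
      < base x j + Z.of_nat (5 * h))%Z) ->
  derives n (s + half_cost * h) (window (6 * h) c base)
    (window (6 * h) (fun x => tc_run h (c x)) base).
Proof.
  intros Hh IH c base Hq Hhead.
  (* The number of the block containing the head, which depends on the input [x]. *)
  set (off := fun x j => Z.to_nat ((tc_head (c x) j - base x j) / Z.of_nat h)).
  assert (forall x j, j < ntapes -> 1 <= off x j <= 4 /\
    (base x j + Z.of_nat (off x j * h) <= tc_head (c x) j
     < base x j + Z.of_nat (off x j * h + h))%Z) as Hoff.
  { intros x j Hj; specialize (Hhead x j Hj); unfold off.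
    set (d := (tc_head (c x) j - base x j)%Z) in *.
    pose proof (Z.div_mod d (Z.of_nat h)) as E.
    pose proof (Z.mod_pos_bound d (Z.of_nat h)).
    assert (1 <= d / Z.of_nat h)%Z by (apply Z.div_le_lower_bound; lia).
    assert (d / Z.of_nat h < 5)%Z by (apply Z.div_lt_upper_bound; lia).
    split; [lia|]. rewrite Nat2Z.inj_add, Nat2Z.inj_mul, Z2Nat.id by lia.
    unfold d in *; nia. }
  set (base' := fun x j => (base x j + Z.of_nat ((off x j - 1) * h))%Z).
  set (sel := flat_map (fun j =>
    map (fun o x => Nat.eqb (off x j) o) [1; 2; 3; 4]) (seq 0 ntapes)).
  set (A := window (6 * h) c base).
  assert (Hlsel : length sel = ntapes * 4).
  { unfold sel; erewrite length_flat_map_const; [now rewrite length_seq|reflexivity]. }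
  assert (derives n ((h * 1 + 4) * length sel) A sel) as Hsel.
  { apply derives_each; intros g Hg.
    apply in_flat_map in Hg as (j & Hj & Hg); apply in_seq in Hj.
    apply in_map_iff in Hg as (o & <- & Ho).
    assert (1 <= o <= 4) as Ho' by (simpl in Ho; lia).
    (* The head is in block [o] exactly when one of the [h] marker bits of that block is set. *)
    replace h with (length (seq (o * h) h)) at 1 by apply length_seq.
    eapply derives_ext; [apply (derives_existsb n (seq (o * h) h) 0 A
      (fun i x => cell_bit (c x) j None (base x j + Z.of_nat i)%Z) n_pos)|].
    - intros i Hi; apply in_seq in Hi; apply derives_in, window_cell; nia.
    - intros x _; apply eq_true_iff_eq; rewrite existsb_exists, Nat.eqb_eq; simpl.
      destruct (Hoff x j) as [Ho1 Ho2]; [lia|]. split.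
      + intros (i & Hi & He); apply in_seq in Hi; apply Z.eqb_eq in He.
        assert (off x j * h < o * h + h) by lia.
        assert (o * h < off x j * h + h) by lia. nia.
      + intros He; rewrite He in Ho2.
        exists (Z.to_nat (tc_head (c x) j - base x j)).
        rewrite in_seq, Z.eqb_eq; split; lia. }
  (* A switch on the four block numbers with free selectors and branches costs
     [4 * (0 + 0 + 2) + 4 = 12]. *)
  assert (forall B r j (P : nat -> list bool -> bool), incl sel B -> j < ntapes ->
    (forall o, 1 <= o <= 4 -> derives n 0 B [P o]) ->
    r = 12 -> derives n r B [fun x => P (off x j) x]) as Hmux.
  { intros B r j P HB Hj HP ->.
    apply (derives_switch n Nat.eqb [1; 2; 3; 4] (fun x => off x j) 0 0 B P
      n_pos Nat.eqb_eq).
    - intros x; destruct (Hoff x j Hj) as [Ho _]; simpl; lia.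
    - intros o Ho; apply derives_in, HB, in_flat_map; exists j.
      split; [apply in_seq; lia|].
      now apply (in_map (fun o x => Nat.eqb (off x j) o)).
    - intros o Ho; apply HP; simpl in Ho; lia. }
  assert (derives n (12 * window_size (3 * h)) (A ++ sel)
            (window (3 * h) c base')) as Hin.
  { apply derives_window.
    - intros i Hi; apply derives_weaken with 0 A
        [fun x => Nat.eqb (tc_state (c x)) i]; auto using incl_refl, incl_appl;
        [|lia]. now apply derives_in, window_state.
    - intros j k i Hj Hi.
      eapply derives_ext; [apply (Hmux (A ++ sel) 12 j (fun o x =>
        cell_bit (c x) j k (base x j + Z.of_nat ((o - 1) * h + i))%Z));
        auto using incl_appr, incl_refl|].
      + intros o Ho; apply derives_in, in_or_app; left; apply window_cell; nia.
      + intros x _; unfold base'; simpl; f_equal; lia. }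
  assert (derives n (12 * window_size (6 * h))
    ((A ++ sel) ++ window (3 * h) (fun x => tc_run h (c x)) base')
    (window (6 * h) (fun x => tc_run h (c x)) base)) as Hout.
  { set (A' := window (3 * h) (fun x => tc_run h (c x)) base').
    apply derives_window.
    - intros i Hi; apply derives_weaken with 0 A'
        [fun x => Nat.eqb (tc_state (tc_run h (c x))) i];
        auto using incl_refl, incl_appr; [|lia].
      now apply derives_in, (window_state (3 * h) (fun x => tc_run h (c x))).
    - intros j k i Hj Hi.
      (* For each possible block number, cell [i] is taken from the simulated blocks if it lies in
         them, and from the old window otherwise. *)
      eapply derives_ext; [apply (Hmux ((A ++ sel) ++ A') 12 j (fun o x =>
        if (((o - 1) * h <=? i) && (i <? (o + 2) * h))%nat
        then cell_bit (tc_run h (c x)) j k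
               (base' x j + Z.of_nat (i - (o - 1) * h))%Z
        else cell_bit (c x) j k (base x j + Z.of_nat i)%Z)); auto|].
      + auto using incl_appl, incl_appr, incl_refl.
      + intros o Ho; apply derives_in.
        assert ((o + 2) * h = (o - 1) * h + 3 * h) as E by nia.
        destruct (Nat.leb_spec ((o - 1) * h) i);
          [destruct (Nat.ltb_spec i ((o + 2) * h))|]; simpl.
        * apply in_or_app; right.
          apply (window_cell (3 * h) (fun x => tc_run h (c x)) base'); lia.
        * apply in_or_app; left; apply in_or_app; left; now apply window_cell.
        * apply in_or_app; left; apply in_or_app; left; now apply window_cell.
      + intros x _; destruct (Hoff x j Hj) as [Ho1 Ho2].
        pose proof (tc_run_head h (c x) j) as Hd; cbv beta.
        (* The inequality is strict because of the marker bit: after [h] steps the head itself may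
           be at distance exactly [h]. *)
        assert (forall z, (Z.of_nat h < Z.abs (z - tc_head (c x) j))%Z ->
          cell_bit (c x) j k z = cell_bit (tc_run h (c x)) j k z) as Hfar.
        { intros z Hz; destruct k; simpl.
          - rewrite tc_run_cell; [reflexivity|lia].
          - apply eq_true_iff_eq; rewrite !Z.eqb_eq; lia. }
        assert (off x j * h = (off x j - 1) * h + h) as E1 by nia.
        assert ((off x j + 2) * h = (off x j - 1) * h + 3 * h) as E2 by nia.
        unfold base'; rewrite E2; rewrite E1 in Ho2.
        destruct (Nat.leb_spec ((off x j - 1) * h) i);
          [destruct (Nat.ltb_spec i ((off x j - 1) * h + 3 * h))|]; simpl.
        * f_equal; lia.
        * apply Hfar; lia.
        * apply Hfar; lia. }
  assert (derives n s (window (3 * h) c base')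
    (window (3 * h) (fun x => tc_run h (c x)) base')) as Hmid.
  { apply IH; [exact Hq|]; intros x j Hj; destruct (Hoff x j Hj) as [Ho1 Ho2].
    assert (off x j * h = (off x j - 1) * h + h) as E1 by nia.
    rewrite E1 in Ho2; unfold base'; lia. }
  eapply derives_weaken.
  - eapply derives_trans; [apply derives_keep, Hsel|].
    eapply derives_trans; [apply derives_keep|exact Hout].
    eapply derives_trans; [exact Hin|exact Hmid].
  - rewrite Hlsel; unfold window_size, half_cost; nia.
  - apply incl_refl.
  - apply incl_refl.
Qed.

Lemma tc_run_add s t c : tc_run (s + t) c = tc_run s (tc_run t c).
Proof. apply Nat.iter_add. Qed.

Definition step_cost : nat := local_cost * window_size 3.

(** The costs satisfy [s (k + 1) = 2 * (s k + half_cost * 2 ^ k)], which yields the factor [k]. The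
    induction is over all [c] and [base], because the recursive windows start at positions depending
    on the input. *)
Lemma derives_run k : forall c base,
  (forall x, tc_state (c x) < nstates) ->
  (forall x j, j < ntapes ->
     (base x j + Z.of_nat (2 ^ k) <= tc_head (c x) j
      < base x j + Z.of_nat (2 * 2 ^ k))%Z) ->
  derives n (2 ^ k * (step_cost + half_cost * k)) (window (3 * 2 ^ k) c base)
    (window (3 * 2 ^ k) (fun x => tc_run (2 ^ k) (c x)) base).
Proof.
  induction k as [|k IH]; intros c base Hq Hh.
  - eapply derives_weaken; [apply (derives_step c base Hq)| | |].
    + intros x j Hj; specialize (Hh x j Hj); change (2 ^ 0) with 1 in Hh; lia.
    + fold step_cost; simpl; lia.
    + apply incl_refl.
    + apply incl_refl.
  - assert (1 <= 2 ^ k) as Hk by (pose proof (Nat.pow_nonzero 2 k); lia).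
    set (s := 2 ^ k * (step_cost + half_cost * k)) in IH.
    replace (2 ^ S k) with (2 ^ k + 2 ^ k) in * by (simpl; lia).
    set (h := 2 ^ k) in *.
    replace (3 * (h + h)) with (6 * h) by lia.
    eapply derives_weaken with
      (s := (s + half_cost * h) + (s + half_cost * h))
      (B := window (6 * h) (fun x => tc_run h (tc_run h (c x))) base).
    (* The head starts in block 2 or 3 of the six; after the first [h] steps it is in one of the
       blocks 1 to 4, so [derives_half] applies a second time. *)
    + eapply derives_trans.
      * apply (derives_half h s Hk IH c base Hq).
        intros x j Hj; specialize (Hh x j Hj); lia.
      * apply (derives_half h s Hk IH (fun x => tc_run h (c x)) base).
        -- intros x; now apply tc_run_state.
        -- intros x j Hj; specialize (Hh x j Hj).
           pose proof (tc_run_head h (c x) j); lia.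
    + unfold s; nia.
    + apply incl_refl.
    + replace (fun x => tc_run (h + h) (c x))
        with (fun x => tc_run h (tc_run h (c x))); [apply incl_refl|].
      apply functional_extensionality; intros x; symmetry; apply tc_run_add.
Qed.

End Simulation.

(** * Turing machines with input tapes as tape machines *)

(** Halting, by a final state or for lack of a rule, becomes idling: the scanned symbols are written
    back and no head moves. *)
Definition tm_delta (M : TM) (q : nat) (l : list sym) : nat * (nat -> sym * mv) :=
  let stay := (q, fun j => (nth j l SB, MS)) in
  if is_final M q then stay
  else match find (fun r => Nat.eqb (r_state r) q && syms_eqb (r_read r) l)
               (tm_rules M) with
       | Some r =>
           (r_next r, fun j =>
              (if j <? tm_nin M then nth j l SB
               else nth (j - tm_nin M) (r_write r) SB, nth j (r_move r) MS))
       | None => stay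
       end.

(** Strictly above the start state and every rule target, so no run leaves the range; the final
    states are included so that acceptance is a wire of the window. *)
Definition tm_nstates (M : TM) : nat :=
  S (list_max (tm_start M :: tm_acc M :: tm_rej M :: map r_next (tm_rules M))).

Lemma tm_nstates_gt M q :
  In q (tm_start M :: tm_acc M :: tm_rej M :: map r_next (tm_rules M)) ->
  q < tm_nstates M.
Proof.
  intros H; unfold tm_nstates; apply le_n_S.
  generalize (le_n (list_max (tm_start M :: tm_acc M :: tm_rej M ::
    map r_next (tm_rules M)))); rewrite list_max_le, Forall_forall; auto.
Qed.

Lemma tm_delta_state M q l :
  q < tm_nstates M -> fst (tm_delta M q l) < tm_nstates M.
Proof.
  intros Hq; unfold tm_delta; destruct (is_final M q); [exact Hq|].
  destruct (find _ _) as [r|] eqn:E; [|exact Hq]; simpl.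
  apply find_some in E as [E _]; apply tm_nstates_gt.
  do 3 right; now apply in_map.
Qed.

Notation tm_ntapes M := (tm_nin M + tm_nwork M).

(** Work tape [j] becomes tape [tm_nin M + j]. The length fields ensure that [combine] truncates
    nothing in [cur_reads] and [apply_rule]. *)
Record represents (M : TM) (ins : list (list bool)) (cf : config)
    (c : tapes_config) : Prop := {
  repr_state : tc_state c = c_state cf;
  repr_inpos : length (c_inpos cf) = tm_nin M;
  repr_work : length (c_work cf) = tm_nwork M;
  repr_in_head : forall j, j < tm_nin M -> tc_head c j = nth j (c_inpos cf) 0%Z;
  repr_in_cell : forall j z, j < tm_nin M ->
    tc_cell c j z = read_in (nth j ins []) z;
  repr_work_head : forall j, j < tm_nwork M ->
    tc_head c (tm_nin M + j) = snd (nth j (c_work cf) (fun _ => SB, 0%Z));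
  repr_work_cell : forall j z, j < tm_nwork M ->
    tc_cell c (tm_nin M + j) z = fst (nth j (c_work cf) (fun _ => SB, 0%Z)) z }.

Lemma nth_map {T T'} (f : T -> T') l j d d' :
  j < length l -> nth j (map f l) d' = f (nth j l d).
Proof.
  intros Hj; rewrite (nth_indep _ d' (f d)) by now rewrite length_map.
  apply map_nth.
Qed.

Lemma nth_map_seq {T} (f : nat -> T) a m i d :
  i < m -> nth i (map f (seq a m)) d = f (a + i).
Proof.
  intros Hi; rewrite (nth_indep _ d (f 0)) by now rewrite length_map, length_seq.
  now rewrite map_nth, seq_nth.
Qed.

Lemma tc_reads_nth m c j :
  j < m -> nth j (tc_reads m c) SB = tc_cell c j (tc_head c j).
Proof. intros Hj; unfold tc_reads; now rewrite nth_map_seq. Qed.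

Lemma represents_reads M ins cf c :
  length ins = tm_nin M -> represents M ins cf c ->
  tc_reads (tm_ntapes M) c = cur_reads ins cf.
Proof.
  intros Hins [H1 H2 H3 H4 H5 H6 H7].
  unfold tc_reads, cur_reads; rewrite seq_app, map_app; f_equal.
  - apply nth_ext with SB SB.
    + rewrite !length_map, length_seq, length_combine; lia.
    + intros i; rewrite length_map, length_seq; intros Hi.
      rewrite nth_map_seq by exact Hi.
      rewrite (nth_map _ _ _ ([], 0%Z)) by (rewrite length_combine; lia).
      rewrite combine_nth by lia; simpl.
      now rewrite H5, H4.
  - apply nth_ext with SB SB.
    + rewrite !length_map, length_seq; lia.
    + intros i; rewrite length_map, length_seq; intros Hi.
      rewrite nth_map_seq by exact Hi; simpl.
      rewrite (nth_map _ _ _ (fun _ => SB, 0%Z)) by lia.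
      rewrite H7, H6 by exact Hi.
      now destruct (nth i (c_work cf) _).
Qed.

Lemma represents_step M ins cf c :
  tm_wf M -> length ins = tm_nin M -> represents M ins cf c ->
  represents M ins (step M ins cf) (tc_step (tm_ntapes M) (tm_delta M) c).
Proof.
  intros [_ Hwf] Hins Hr.
  pose proof (represents_reads M ins cf c Hins Hr) as Hreads.
  pose proof Hr as [H1 H2 H3 H4 H5 H6 H7].
  assert (tc_delta (tm_ntapes M) (tm_delta M) c =
    (c_state cf, fun j => (nth j (tc_reads (tm_ntapes M) c) SB, MS)) ->
    represents M ins cf (tc_step (tm_ntapes M) (tm_delta M) c)) as Hstay.
  { intros E; split; unfold tc_step; rewrite ?E; simpl; auto.
    - intros j z Hj; rewrite tc_reads_nth by lia.
      destruct (Z.eqb_spec z (tc_head c j)) as [->|]; auto.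
    - intros j z Hj; rewrite tc_reads_nth by lia.
      destruct (Z.eqb_spec z (tc_head c (tm_nin M + j))) as [->|]; auto. }
  unfold step; unfold tc_delta, tm_delta in Hstay; rewrite H1 in Hstay.
  destruct (is_final M (c_state cf)) eqn:Ef; [now apply Hstay|].
  unfold find_rule; rewrite Hreads in Hstay.
  destruct (find _ _) as [r|] eqn:E; [|now apply Hstay].
  assert (tc_delta (tm_ntapes M) (tm_delta M) c = (r_next r, fun j =>
     (if j <? tm_nin M then nth j (tc_reads (tm_ntapes M) c) SB
      else nth (j - tm_nin M) (r_write r) SB, nth j (r_move r) MS))) as Ed.
  { unfold tc_delta, tm_delta; rewrite H1, Ef, Hreads, E; reflexivity. }
  apply find_some in E as [E _]; destruct (Hwf r E) as (Hl1 & Hl2 & Hl3).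
  assert (forall j, j < tm_nwork M ->
    nth j (c_work (apply_rule M r cf)) (fun _ => SB, 0%Z) =
    write_move (nth j (c_work cf) (fun _ => SB, 0%Z))
      (nth j (r_write r) SB) (nth (tm_nin M + j) (r_move r) MS)) as Hw.
  { intros j Hj; simpl.
    rewrite (nth_map _ _ _ ((fun _ => SB, 0%Z), (SB, MS)))
      by (rewrite !length_combine, length_skipn; lia).
    rewrite !combine_nth by (rewrite ?length_combine, length_skipn; lia).
    simpl; now rewrite nth_skipn. }
  split; unfold tc_step; rewrite ?Ed; simpl tc_state; simpl tc_head; simpl tc_cell.
  - reflexivity.
  - simpl; rewrite length_map, length_combine, length_firstn; lia.
  - simpl; rewrite length_map, !length_combine, length_skipn; lia.
  - intros j Hj; simpl.
    rewrite (nth_map _ _ _ (MS, 0%Z))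
      by (rewrite length_combine, length_firstn; lia).
    rewrite combine_nth by (rewrite length_firstn; lia).
    rewrite nth_firstn, (proj2 (Nat.ltb_lt _ _) Hj), H4 by exact Hj.
    reflexivity.
  - intros j z Hj; rewrite (proj2 (Nat.ltb_lt _ _) Hj), tc_reads_nth by lia.
    destruct (Z.eqb_spec z (tc_head c j)) as [->|]; auto.
  - intros j Hj; rewrite Hw, H6 by exact Hj.
    now destruct (nth j (c_work cf) _).
  - intros j z Hj; rewrite Hw, H6, H7 by exact Hj.
    rewrite (proj2 (Nat.ltb_ge _ _)) by lia.
    replace (tm_nin M + j - tm_nin M) with j by lia.
    now destruct (nth j (c_work cf) _).
Qed.

Definition tc_init (M : TM) (ins : list (list bool)) : tapes_config :=
  TapesConfig (tm_start M)
    (fun j z => if j <? tm_nin M then read_in (nth j ins []) z else SB)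
    (fun _ => 0%Z).

Lemma represents_run M ins t :
  tm_wf M -> length ins = tm_nin M ->
  represents M ins (run M ins t)
    (tc_run (tm_ntapes M) (tm_delta M) t (tc_init M ins)).
Proof.
  intros Hwf Hins; induction t as [|t IH].
  - split; simpl; rewrite ?repeat_length; auto.
    + intros j Hj; now rewrite nth_repeat.
    + intros j z Hj; now rewrite (proj2 (Nat.ltb_lt _ _) Hj).
    + intros j Hj; now rewrite nth_repeat.
    + intros j z Hj; rewrite (proj2 (Nat.ltb_ge _ _)) by lia.
      now rewrite nth_repeat.
  - now apply represents_step.
Qed.

(** * Circuits for runs with a hard-wired program *)

Lemma derives_read_in n A z s :
  1 <= n -> derives n 4 A [fun x => sym_eqb (read_in x z) s].
Proof.
  intros Hn; destruct ((0 <=? z)%Z && (z <? Z.of_nat n)%Z) eqn:Ez.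
  - assert (derives n 1 A [fun x => nth (Z.to_nat z) x false]) as Hz.
    { apply andb_prop in Ez as [Ez1 Ez2]; apply derives_input.
      apply Z.leb_le in Ez1; apply Z.ltb_lt in Ez2; lia. }
    assert (forall b : bool -> bool, derives n 4 A [fun x => b (nth (Z.to_nat z) x false)] ->
      (forall a, b a = sym_eqb (bit_sym a) s) ->
      derives n 4 A [fun x => sym_eqb (read_in x z) s]) as Hb.
    { intros b Hd Hb; eapply derives_ext; [exact Hd|].
      intros x Hx; unfold read_in; rewrite Hx, Ez; apply Hb. }
    destruct s.
    + apply (Hb negb); [|now intros []].
      eapply derives_weaken;
        [apply derives_negb, Hz|lia|apply incl_refl|apply incl_refl].
    + apply (Hb (fun a => a)); [|now intros []].
      eapply derives_weaken; [apply Hz|lia|apply incl_refl|apply incl_refl].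
    + apply (Hb (fun _ => false)); [|now intros []].
      now apply derives_const.
  - eapply derives_ext; [now apply (derives_const n A (sym_eqb SB s))|].
    intros x Hx; unfold read_in; now rewrite Hx, Ez.
Qed.

(** The common factor 4 is the price of the unique sink in [available_circuit]; the first summand
    covers the initial window, at 4 vertices per bit. *)
Definition circuit_cost (M : TM) : nat :=
  16 * (tm_nstates M + 12 * tm_ntapes M) +
  4 * step_cost (tm_ntapes M) (tm_nstates M) +
  4 * half_cost (tm_ntapes M) (tm_nstates M).

Lemma circuit_of_run M n h k :
  tm_wf M -> tm_nin M = 2 -> 1 <= n ->
  exists C, circuit_ok n C /\ length C <= circuit_cost M * (2 ^ k * (k + 1)) /\
    forall x, length x = n ->
      circuit_out x C = Nat.eqb (c_state (run M [h; x] (2 ^ k))) (tm_acc M).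
Proof.
  intros Hwf Hnin Hn.
  set (c := fun x => tc_init M [h; x]).
  (* This puts the initial head position 0 on the first cell of the middle block. *)
  set (base := fun (_ : list bool) (_ : nat) => (- Z.of_nat (2 ^ k))%Z).
  assert (derives n (4 * window_size (tm_ntapes M) (tm_nstates M) (3 * 2 ^ k)) []
    (window (tm_ntapes M) (tm_nstates M) (3 * 2 ^ k) c base)) as Hinit.
  { apply derives_window.
    - intros i _; now apply (derives_const n [] (tm_start M =? i)).
    - intros j [s|] i _ _; simpl.
      2: now apply (derives_const n []
             (0 =? - Z.of_nat (2 ^ k) + Z.of_nat i)%Z).
      (* Tape 0 holds the fixed program [h], tape 1 the circuit input [x], and the others are
         blank. *)
      rewrite Hnin; destruct j as [|[|j]]; simpl.
      + now apply (derives_const n [] (sym_eqb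
          (read_in h (- Z.of_nat (2 ^ k) + Z.of_nat i)) s)).
      + now apply (derives_read_in n [] (- Z.of_nat (2 ^ k) + Z.of_nat i)).
      + now apply (derives_const n [] (sym_eqb SB s)). }
  assert (In (tm_acc M) (tm_start M :: tm_acc M :: tm_rej M ::
    map r_next (tm_rules M))) as Hacc by (right; now left).
  apply tm_nstates_gt in Hacc.
  destruct (derives_trans _ _ _ _ _ _ Hinit
    (derives_run (tm_ntapes M) (tm_nstates M) (tm_delta M)
      (tm_delta_state M) n Hn k c base
      ltac:(intros x; apply tm_nstates_gt; now left)
      ltac:(intros x j _; change (tc_head (c x) j) with 0%Z; unfold base;
            pose proof (Nat.pow_nonzero 2 k); lia)) [])
    as (D & HD & HDwf & Hav).
  { intros i Hi; simpl in Hi; lia. }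
  { intros g []. }
  destruct (available_circuit n ([] ++ D) _ HDwf (Hav _
    (window_state _ _ _ _ _ (tm_acc M) Hacc)))
    as (C & Hok & Hlen & Hout).
  exists C; split; [exact Hok|split].
  - eapply Nat.le_trans; [exact Hlen|]; simpl length.
    eapply Nat.le_trans; [apply Nat.mul_le_mono_l, HD|].
    assert (1 <= 2 ^ k) by (pose proof (Nat.pow_nonzero 2 k); lia).
    unfold circuit_cost, window_size.
    set (a := step_cost _ _); set (b := half_cost _ _).
    set (w := 2 ^ k) in *; nia.
  - intros x Hx; rewrite Hout by exact Hx; unfold c.
    now rewrite (repr_state _ _ _ _ (represents_run M [h; x] (2 ^ k) Hwf
      (eq_sym Hnin))).
Qed.

Lemma run_halted M ins t t' :
  halted M ins (run M ins t) -> t <= t' -> run M ins t' = run M ins t.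
Proof.
  intros Hh Ht; induction Ht as [|t' Ht IH]; [reflexivity|].
  change (run M ins (S t')) with (step M ins (run M ins t')); rewrite IH.
  unfold step; destruct Hh as [E|E].
  - now rewrite E.
  - rewrite E; now destruct (is_final _ _).
Qed.

(** [tm_output] only provides some time at which a final state is reached. Halted configurations are
    fixed points, so the one at that time is the one at time [t]. *)
Lemma output_of_halted M ins t b :
  tm_wf M -> halted M ins (run M ins t) -> tm_output M ins (Some b) ->
  Nat.eqb (c_state (run M ins t)) (tm_acc M) = b.
Proof.
  intros [Hne _] Hh Ho.
  assert (forall t', is_final M (c_state (run M ins t')) = true ->
    run M ins t' = run M ins t) as Heq.
  { intros t' H; destruct (Nat.le_ge_cases t t').
    - now apply run_halted.
    - symmetry; apply run_halted; [now left|assumption]. }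
  destruct b, Ho as [t' E]; rewrite <- (Heq t'), E; unfold is_final;
    rewrite ?E, ?Nat.eqb_refl, ?orb_true_r; auto.
  apply Nat.eqb_neq; auto.
Qed.

(** * Encoding lengths *)

Lemma circ_enc_len_bound G c b :
  exists K, forall n s, 2 <= n ->
    s <= G * (2 ^ (c * Nat.log2_up n + b) * (c * Nat.log2_up n + b + 1)) ->
    circ_enc_len s n <= K * (n ^ c * Nat.log2_up n ^ 2).
Proof.
  (* With [L] for [Nat.log2_up n], the power of 2 comes from [2 ^ L <= 2 * n], the last factor from
     [c * L + b + 1 <= (c + b + 1) * L]; together [s <= G' * (n ^ c * L)]. *)
  set (G' := G * 2 ^ (b + c) * (c + b + 1)).
  exists (4 + G' * (3 + 2 * (G' + c + 1))); intros n s Hn Hs.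
  set (L := Nat.log2_up n) in *.
  assert (1 <= L) as HL by (apply Nat.log2_up_pos; lia).
  destruct (Nat.log2_up_spec n) as [HLn HLn']; [lia|]; fold L in HLn, HLn'.
  assert (2 ^ L <= 2 * n) as H2L.
  { replace L with (S (Nat.pred L)) by lia; simpl; lia. }
  assert (2 ^ (c * L + b) <= 2 ^ (b + c) * n ^ c) as Hpow.
  { rewrite Nat.mul_comm, Nat.add_comm, !Nat.pow_add_r, Nat.pow_mul_r.
    rewrite <- Nat.mul_assoc, <- Nat.pow_mul_l.
    apply Nat.mul_le_mono_l, Nat.pow_le_mono_l, H2L. }
  assert (1 <= n ^ c) as Hnc by (pose proof (Nat.pow_nonzero n c); lia).
  assert (s <= G' * (n ^ c * L)) as Hs'.
  { eapply Nat.le_trans; [exact Hs|]; unfold G'.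
    assert (c * L + b + 1 <= (c + b + 1) * L) by nia.
    replace (G * 2 ^ (b + c) * (c + b + 1) * (n ^ c * L)) with
      (G * ((2 ^ (b + c) * n ^ c) * ((c + b + 1) * L))) by ring.
    now apply Nat.mul_le_mono_l, Nat.mul_le_mono. }
  (* Each factor of [G' * (n ^ c * L)] is at most a power of 2, with exponents [G'], [L * c] and
     [L]. So a vertex costs O(L) bits. *)
  assert (Nat.log2_up s <= (G' + c + 1) * L) as Hlog.
  { apply Nat.le_trans with (Nat.log2_up (2 ^ (G' + (L * c + L)))).
    - apply Nat.log2_up_le_mono; eapply Nat.le_trans; [exact Hs'|].
      rewrite !Nat.pow_add_r, Nat.pow_mul_r; apply Nat.mul_le_mono;
        [|apply Nat.mul_le_mono].
      + apply Nat.lt_le_incl, Nat.pow_gt_lin_r; lia.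
      + now apply Nat.pow_le_mono_l.
      + apply Nat.lt_le_incl, Nat.pow_gt_lin_r; lia.
    - rewrite Nat.log2_up_pow2 by lia; nia. }
  unfold circ_enc_len; fold L.
  assert (Nat.max (2 * Nat.log2_up s) L <= 2 * (G' + c + 1) * L) as Hmax by nia.
  assert (s * (3 + Nat.max (2 * Nat.log2_up s) L) <=
    G' * (n ^ c * L) * ((3 + 2 * (G' + c + 1)) * L)) as Hprod.
  { apply Nat.mul_le_mono; [exact Hs'|nia]. }
  assert (2 * L + 2 <= 4 * (n ^ c * L ^ 2)) by (simpl; nia).
  simpl Nat.pow in *; nia.
Qed.

(** Rounding up adds at most 1, and [1 <= log2R (INR n)] for [n >= 2]. *)
Lemma log2_up_le_log2R n :
  2 <= n -> (INR (Nat.log2_up n) <= 2 * log2R (INR n))%R.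
Proof.
  intros Hn; assert (1 <= Nat.log2_up n) as HL by (apply Nat.log2_up_pos; lia).
  destruct (Nat.log2_up_spec n) as [Hpow _]; [lia|].
  set (L := Nat.log2_up n) in *.
  assert (0 < ln 2)%R as Hln2 by (rewrite <- ln_1; apply ln_increasing; lra).
  assert (0 < INR n)%R as Hn0 by (apply lt_0_INR; lia).
  assert (forall m, 2 ^ m <= n -> (INR m <= log2R (INR n))%R) as Hm.
  { intros m H; unfold log2R.
    apply Rmult_le_reg_r with (ln 2); [exact Hln2|].
    unfold Rdiv; rewrite Rmult_assoc, Rinv_l, Rmult_1_r by lra.
    rewrite <- ln_pow by lra.
    assert (2 ^ m <= INR n)%R as H'.
    { apply le_INR in H; rewrite pow_INR in H; simpl in H.
      now replace (1 + 1)%R with 2%R in H by lra. }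
    destruct H' as [H'| ->]; [|lra].
    apply Rlt_le, ln_increasing; [apply pow_lt; lra|exact H']. }
  pose proof (Hm 1 ltac:(simpl; lia)) as H1; simpl in H1.
  pose proof (Hm (Nat.pred L) ltac:(lia)) as H2.
  replace L with (S (Nat.pred L)) by lia; rewrite S_INR; lra.
Qed.

(** * Shortest circuit descriptions and the ratio bound *)

Lemma circ_desc_len_exists n f C :
  circuit_ok n C -> (forall x, length x = n -> circuit_out x C = f x) ->
  exists k, circ_desc_len n f k /\ k <= circ_enc_len (length C) n.
Proof.
  intros HC Hf.
  set (P := fun k => exists C, circuit_ok n C /\
    (forall x, length x = n -> circuit_out x C = f x) /\
    circ_enc_len (length C) n = k).
  destruct (dec_inh_nat_subset_has_unique_least_element P) as (k & [Hk Hmin] & _).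
  - intros k; apply classic.
  - now exists (circ_enc_len (length C) n), C.
  - exists k; split; [split; [exact Hk|]|].
    + intros C' H1 H2; apply Hmin; now exists C'.
    + apply Hmin; now exists C.
Qed.

Theorem mainTheorem11 :
  forall (c : nat), 1 <= c ->
  forall (E : TM -> list bool) (U : TM),
    prefix_free_encoding E ->
    universal_interp c E U ->
    exists (K : R) (N : nat), (0 < K)%R /\
      forall n : nat, N <= n -> 1 <= n ->
        sup_ratio_le E U n (K * INR n ^ c * (log2R (INR n)) ^ 2)%R.
Proof.
  intros c Hc E U _ (Hwf & Hnin & _ & [beta Hhalt] & _).
  destruct (circ_enc_len_bound (circuit_cost U) c beta) as [K HK].
  (* The 4 is the square of the factor 2 in [log2_up_le_log2R]; adding 1 makes the constant
     positive. *)
  exists (4 * (INR K + 1))%R, 2; split; [pose proof (pos_INR K); lra|].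
  intros n Hn Hn1 f kU [(h & Hh & Hcomp) _].
  (* Then [2 ^ k] covers the running time, as [n <= 2 ^ Nat.log2_up n] and [beta < 2 ^ beta], while
     exceeding [n ^ c] only by a constant factor. *)
  set (k := c * Nat.log2_up n + beta).
  destruct (circuit_of_run U n h k Hwf Hnin Hn1) as (C & HC & Hlen & Hout).
  assert (beta * n ^ c <= 2 ^ k) as Htime.
  { unfold k; rewrite Nat.pow_add_r, (Nat.mul_comm c), Nat.pow_mul_r, Nat.mul_comm.
    apply Nat.mul_le_mono.
    - apply Nat.pow_le_mono_l, Nat.log2_up_spec; lia.
    - apply Nat.lt_le_incl, Nat.pow_gt_lin_r; lia. }
  destruct (circ_desc_len_exists n f C HC) as (kC & HkC & Hle).
  { intros x Hx; rewrite Hout by exact Hx.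
    apply output_of_halted; [exact Hwf| |now apply Hcomp].
    assert (1 <= length x) as Hx1 by lia.
    specialize (Hhalt h x Hx1); rewrite Hx in Hhalt.
    now rewrite (run_halted U [h; x] _ (2 ^ k) Hhalt Htime). }
  exists kC; split; [exact HkC|].
  apply Rle_trans with (INR kC).
  (* A denominator 0 makes the quotient 0 by [Rinv_0]; a denominator at least 1 leaves it at most
     [INR kC]. *)
  - destruct kU as [|kU].
    + simpl; unfold Rdiv; rewrite Rinv_0, Rmult_0_r; apply pos_INR.
    + apply Rmult_le_reg_r with (INR (S kU)); [apply lt_0_INR; lia|].
      unfold Rdiv; rewrite Rmult_assoc, Rinv_l, Rmult_1_r
        by (apply not_0_INR; lia).
      rewrite <- mult_INR; apply le_INR; nia.
  - pose proof (HK n (length C) Hn Hlen) as H.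
    apply (Nat.le_trans _ _ _ Hle), le_INR in H.
    rewrite !mult_INR, !pow_INR in H.
    pose proof (log2_up_le_log2R n Hn) as HL.
    pose proof (pos_INR (Nat.log2_up n)) as HL0; pose proof (pos_INR K) as HK0.
    set (l := INR (Nat.log2_up n)) in *; set (l' := log2R (INR n)) in *.
    assert (0 <= INR n ^ c)%R as Hp by apply pow_le, pos_INR.
    assert (l ^ 2 <= 4 * l' ^ 2)%R as Hl by nra.
    eapply Rle_trans; [exact H|].
    apply Rle_trans with (INR K * (INR n ^ c * (4 * l' ^ 2)))%R.
    + apply Rmult_le_compat_l, Rmult_le_compat_l; assumption.
    + assert (0 <= INR n ^ c * l' ^ 2)%R
        by (apply Rmult_le_pos; [assumption|apply pow2_ge_0]).
      nra.
Qed.
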